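(* Let $\mathcal{F}$ be the folded component (with vertex set $\{0,1,\dots,\mathrm{ord}(\ell)-1\}$ and edges as specified in the context), and let $d$ be its graph distance. Let $v,w\in V(\mathcal{F})\setminus\{0\}$. Then $$d(v,w)=\begin{cases}\frac12|v-w| & \text{if } 2\nmid v \text{ and } 2\nmid w,\ \text{or } v=w,\\ \frac12|v-w-1|+1 & \text{if } 2\mid v\text{ and }2\nmid w,\\ \frac12|v-w|+2 & \text{if } 2\mid v,\ 2\mid w\text{ and } v\neq w.\end{cases}$$ (The remaining case, $v$ odd and $w$ even, is covered by the symmetry $d(v,w)=d(w,v)$.)
   Context: Let $p$ be a prime with $p\equiv 71$ or $119\pmod{120}$, let $\ell=2$, and let $\mathrm{ord}(\ell)$ be the order, in the ideal class group of $\mathbb{Q}(\sqrt{-p})$, of a prime ideal above $2$; it is an odd integer $\ge 3$. The folded component $\mathcal{F}$ (a component of the supersingular $2$-isogeny graph over $\mathbb{F}_p$ after identifying curves up to $\overline{\mathbb{F}_p}$-isomorphism, regarded as a simple undirected graph) is labelled so that $V(\mathcal{F})=\{0,1,\dots,\mathrm{ord}(\ell)-1\}$ and $$E(\mathcal{F})=\{\{2k-1,2k+1\}: 1\le k\le \tfrac12(\mathrm{ord}(\ell)-3)\}\cup\{\{2k+1,2k+2\}:0\le k\le \tfrac12(\mathrm{ord}(\ell)-3)\}\cup\{\{0,1\}\}.$$ The distance $d(v,w)$ is the minimum number of edges of a path from $v$ to $w$. *)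

(* Defs.v *)
(* [set] and the set notations below are the Prop-valued ones of classical_sets,
   not those of finset. *)
From HB Require Import structures.
From mathcomp Require Import all_boot all_order all_algebra all_field.
From mathcomp Require Import classical_sets.

Set Implicit Arguments.
Unset Strict Implicit.
Unset Printing Implicit Defensive.

Import Order.TTheory GRing.Theory Num.Theory.
Local Open Scope ring_scope.
Local Open Scope classical_set_scope.

(* Q(sqrt(-p)) as a subfield of the field of algebraic numbers. *)
Definition quad_field (p : nat) : set algC :=
  [set x | exists a b : rat, x = ratr a + ratr b * sqrtC (- p%:R)].

Definition quad_int (p : nat) : set algC :=
  [set x | quad_field p x /\ x \in Aint].

(* [O] stands for a subring of [algC], given as a set, as in all of the ideal
   theory below. *)
Record is_ideal (O I : set algC) : Prop := IsIdeal {
  ideal_sub : I `<=` O;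
  ideal_0 : I 0;
  ideal_add : forall x y, I x -> I y -> I (x + y);
  ideal_mulr : forall a x, O a -> I x -> I (a * x) }.

Record is_prime_ideal (O P : set algC) : Prop := IsPrimeIdeal {
  prime_ideal_ideal : is_ideal O P;
  prime_ideal_proper : P <> O;
  prime_ideal_mul : forall x y, O x -> O y -> P (x * y) -> P x \/ P y }.

(* The intersection of [P] with the integers is generated by [l]. *)
Definition lies_above (P : set algC) (l : nat) : Prop :=
  forall z : int, P z%:~R <-> (l %| z)%Z.

Definition ideal_prod (I J : set algC) : set algC :=
  [set x | exists (m : nat) (a b : 'I_m -> algC),
     [/\ forall i, I (a i), forall i, J (b i) & x = \sum_i a i * b i]].

Definition ideal_pow (O I : set algC) (m : nat) : set algC :=
  iter m (ideal_prod I) O.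

(* Equality of ideal classes, for nonzero ideals. *)
Definition same_class (O I J : set algC) : Prop :=
  exists a b : algC, [/\ O a, O b, a != 0, b != 0 &
    [set a * x | x in I] = [set b * x | x in J]].

(* [n] is the order of the class of [I] in the ideal class group of [O], whose
   neutral element is the class of [O]. *)
Definition is_class_order (O I : set algC) (n : nat) : Prop :=
  [/\ (0 < n)%N, same_class O (ideal_pow O I n) O &
      forall m, (0 < m < n)%N -> ~ same_class O (ideal_pow O I m) O].

Local Open Scope nat_scope.

Definition unordered_eq (a b v w : nat) : bool :=
  ((v == a) && (w == b)) || ((v == b) && (w == a)).

(* Adjacency in the folded component on {0, ..., n-1}, where [n] stands for the
   class order.  The bound k <= (n-3)/2 is written 2k + 3 <= n, so that no
   truncated operation on [n] occurs; it implies k < n, whence k : 'I_n. *)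
Definition folded_adj (n : nat) : rel 'I_n := fun v w =>
  [|| [exists k : 'I_n, [&& 1 <= k, 2 * k + 3 <= n &
         unordered_eq (2 * k - 1) (2 * k + 1) v w]],
      [exists k : 'I_n, (2 * k + 3 <= n) &&
         unordered_eq (2 * k + 1) (2 * k + 2) v w]
    | unordered_eq 0 1 v w].

(* Least number of edges of a path from [v] to [w].  A path has pairwise
   distinct vertices, hence fewer than #|T| edges; the value is #|T| when
   there is no path. *)
Definition graph_dist (T : finType) (e : rel T) (v w : T) : nat :=
  find (fun m => [exists s : m.-tuple T,
                    [&& path e v s, uniq (v :: s) & last v s == w]])
       (iota 0 #|T|).

(* Main.v *)
(* For an even class order n >= 4 the last vertex n - 1 would be isolated, so one
   needs that n is odd.  If P^(2m) = (c), write c = (x + y sqrt(-p)) / 2; then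
   x^2 + p y^2 = 2^(2m+2), and x is odd since the unramified P^(2m) is not divisible
   by 2.  So (2^(m+1) - x) (2^(m+1) + x) = p y^2 has coprime factors, a square and p
   times a square, whence c = +-b^2 with b in the ring of integers; the latter being
   integrally closed, P^m = (b).
   For odd n the component is the path 1, 3, ..., n - 2 with a leaf 2k + 2 at each
   2k + 1 and one more leaf 0 at 1, where distances can be read off. *)
Require Import Defs.
From HB Require Import structures.
From mathcomp Require Import all_boot all_order all_algebra all_field.
From mathcomp Require Import classical_sets.
From mathcomp Require Import zify ring.

Set Implicit Arguments.
Unset Strict Implicit.
Unset Printing Implicit Defensive.

Import Order.TTheory GRing.Theory Num.Theory.
Local Open Scope ring_scope.
Local Open Scope classical_set_scope.

(** * Sums of a square and p times a square *)

(** With [g = gcdn a c], [a = a1 * g] and [c = c1 * g], one gets [a1 * b = g * c1 ^ 2]; coprimality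
    then gives [a1 %| g] and [g %| a1], so [a = g ^ 2]. *)
Lemma coprime_mul_sqr (a b c : nat) :
  coprime a b -> (a * b = c ^ 2)%N -> exists d, a = (d ^ 2)%N.
Proof.
move=> cop_ab ab_c2.
have [a0|a_gt0] := posnP a; first by exists 0%N; rewrite a0.
pose g := gcdn a c; have g_gt0 : (0 < g)%N by rewrite gcdn_gt0 a_gt0.
pose a1 := (a %/ g)%N; pose c1 := (c %/ g)%N.
have aE : a = (a1 * g)%N by rewrite /a1 divnK // dvdn_gcdl.
have cE : c = (c1 * g)%N by rewrite /c1 divnK // dvdn_gcdr.
have cop1 : coprime a1 c1.
  by rewrite /coprime -(eqn_pmul2r g_gt0) muln_gcdl -aE -cE mul1n.
have cop_gb : coprime g b by apply: coprime_dvdl cop_ab; exact: dvdn_gcdl.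
have eq1 : (a1 * b = g * c1 ^ 2)%N.
  apply/eqP; rewrite -(eqn_pmul2r g_gt0); apply/eqP.
  by rewrite mulnAC -aE ab_c2 {1}cE; lia.
have dvd_a1g : (a1 %| g)%N.
  by rewrite -(@Gauss_dvdl _ _ (c1 ^ 2)) ?coprimeXr // -eq1 dvdn_mulr.
have dvd_ga1 : (g %| a1)%N by rewrite -(@Gauss_dvdl _ _ b) // eq1 dvdn_mulr.
have e : a1 = g by apply/eqP; rewrite eqn_dvd dvd_a1g.
by exists g; rewrite {1}aE e; lia.
Qed.

(** By symmetry [p] divides [b]; once [p] is removed, two coprime factors with product [c ^ 2]
    remain, and both are squares. *)
Lemma coprime_mul_prime_sqr (p a b c : nat) :
  prime p -> coprime a b -> (a * b = p * c ^ 2)%N ->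
  exists d e, c = (d * e)%N /\
    ((a = d ^ 2 /\ b = p * e ^ 2)%N \/ (a = p * e ^ 2 /\ b = d ^ 2)%N).
Proof.
move=> p_prime.
wlog p_dvd_b : a b / (p %| b)%N => [wlog_b|] cop_ab ab_pc2.
  have : (p %| a * b)%N by rewrite ab_pc2 dvdn_mulr.
  rewrite Euclid_dvdM // => /orP[p_dvd_a|]; last by move/wlog_b; apply.
  have [||d [e [-> H]]] := wlog_b b a p_dvd_a.
  - by rewrite coprime_sym.
  - by rewrite mulnC.
  by exists d, e; split=> //; case: H => -[-> ->]; [right|left].
case/dvdnP: p_dvd_b cop_ab ab_pc2 => b1 -> cop_ab ab_pc2.
have p_gt0 := prime_gt0 p_prime.
have ab1 : (a * b1 = c ^ 2)%N.
  by apply/eqP; rewrite -(eqn_pmul2r p_gt0) -mulnA ab_pc2 mulnC.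
have cop1 : coprime a b1 by apply: coprime_dvdr cop_ab; rewrite dvdn_mulr.
have [d aE] := coprime_mul_sqr cop1 ab1.
have [e bE] : exists e, b1 = (e ^ 2)%N.
  by apply: (@coprime_mul_sqr b1 a c); rewrite 1?coprime_sym // mulnC ab1.
exists d, e; split; last by left; rewrite -aE bE mulnC.
by apply/eqP; rewrite -(eqn_exp2r _ _ (isT : 0 < 2)%N) expnMn -aE -bE ab1.
Qed.

(** In other terms, (a + b sqrt(-p)) / 2 has norm 2^m and its square is (x + y sqrt(-p)) / 2 up to
    sign; the sign depends on which factor carries [p]. *)
Lemma norm_eq_even_pow2 (p m : nat) (x y : int) :
  prime p -> ~~ (2 %| x)%Z -> x ^+ 2 + p%:Z * y ^+ 2 = 2 ^+ (2 * m.+1) ->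
  exists a b : int, a ^+ 2 + p%:Z * b ^+ 2 = 2 ^+ m.+2 /\
    ((a ^+ 2 - p%:Z * b ^+ 2 = 2 * x /\ a * b = y) \/
     (a ^+ 2 - p%:Z * b ^+ 2 = - (2 * x) /\ a * b = - y)).
Proof.
move=> p_prime x_odd; rewrite mulnC exprM.
move DM: (2 ^+ m.+1 : int) => M eqM.
have M_gt0 : 0 < M by rewrite -DM exprn_gt0.
have M_dvd k : (k %| M)%Z -> ~~ (2 %| k)%Z -> `|k|%N = 1%N.
  move=> k_dvd k_odd; apply/eqP; rewrite -dvdn1.
  have : coprime `|k| (2 ^ m.+1)%N by rewrite coprimeXr // coprimen2; lia.
  move/Gauss_dvdr => <-; rewrite muln1.
  by move: k_dvd; rewrite -DM dvdzE abszX.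
have prodE : (M - x) * (M + x) = p%:Z * y ^+ 2 by lia.
have p_gt0 := prime_gt0 p_prime.
have x_neqM : x != M /\ x != - M.
  have : (2 %| M)%Z by rewrite -DM exprS dvdz_mulr.
  by split; apply: contraNneq x_odd => ->; lia.
(* Neither factor vanishes, their product is nonnegative and their sum is [2 * M]. *)
have [A_gt0 B_gt0] : 0 < M - x /\ 0 < M + x.
  have : 0 <= (M - x) * (M + x) by rewrite prodE; nia.
  by nia.
(* A common divisor is odd, because [M - x] is, and it divides the sum [2 * M], a power of 2. *)
have cop : coprime `|M - x| `|M + x|.
  rewrite /coprime; set g := gcdn _ _.
  have gA : (g%:Z %| M - x)%Z by rewrite dvdzE dvdn_gcdl.
  have gB : (g%:Z %| M + x)%Z by rewrite dvdzE dvdn_gcdr.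
  have g_odd : ~~ (2 %| g%:Z)%Z.
    apply: contra x_odd => /dvdz_trans/(_ gA).
    have : (2 %| M)%Z by rewrite -DM exprS dvdz_mulr.
    by lia.
  have gM : (g%:Z %| M)%Z.
    have : (g%:Z %| 2 * M)%Z.
      by rewrite (_ : 2 * M = (M - x) + (M + x)); [apply: rpredD|ring].
    by rewrite Gauss_dvdzr // coprimezE coprimen2; lia.
  by rewrite -[g]/(`|g%:Z|)%N (M_dvd _ gM g_odd).
have prodN : (`|(M - x)%R| * `|(M + x)%R| = p * `|y| ^ 2)%N.
  by rewrite -abszM prodE abszM abszX.
have [d [e [yE H]]] := coprime_mul_prime_sqr p_prime cop prodN.
(* The factorization only determines [y] up to its sign [s], which is moved into the witness for
   [b]. *)
have [s [s2 sE]] : exists s : int, s ^+ 2 = 1 /\ y = s * (d%:Z * e%:Z).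
  by exists ((-1) ^+ (y < 0)%R); rewrite sqrr_sign -PoszM -yE -intEsign.
have -> : 2 ^+ m.+2 = 2 * M :> int by rewrite exprS DM.
have sqrE (u v : nat) (z : int) : 0 < z -> `|z|%N = (u * v ^ 2)%N ->
    z = u%:Z * v%:Z ^+ 2.
  by move=> z_gt0 zE; rewrite -(gtz0_abs z_gt0) zE PoszM expnS expn1 PoszM expr2.
case: H => -[HA HB].
  have A_eq : M - x = 1%:Z * d%:Z ^+ 2 by apply: sqrE; rewrite ?mul1n.
  have B_eq := sqrE _ _ _ B_gt0 HB.
  exists d%:Z, (- s * e%:Z); rewrite exprMn sqrrN s2 mul1r; split; first by lia.
  by right; split; [lia|rewrite sE; ring].
have A_eq := sqrE _ _ _ A_gt0 HA.
have B_eq : M + x = 1%:Z * d%:Z ^+ 2 by apply: sqrE; rewrite ?mul1n.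
exists d%:Z, (s * e%:Z); rewrite exprMn s2 mul1r; split; first by lia.
by left; split; [lia|rewrite sE; ring].
Qed.

(** * Integers of Q(sqrt(-p)) *)

Lemma sqrtCNn_sqr (p : nat) : sqrtC (- p%:R) * sqrtC (- p%:R) = - p%:R :> algC.
Proof. by rewrite -expr2 sqrtCK. Qed.

(** The conjugate has the same square, so it is [s] or [- s]; a real [s] would have a nonnegative
    square. *)
Lemma sqrtCNn_conj (p : nat) :
  (0 < p)%N -> (sqrtC (- p%:R))^* = - sqrtC (- p%:R) :> algC.
Proof.
move=> p_gt0; set s := sqrtC _; have s2 : s ^+ 2 = - p%:R by rewrite sqrtCK.
have /eqP : (s^*) ^+ 2 = s ^+ 2 by rewrite -rmorphXn /= s2 rmorphN /= rmorph_nat.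
rewrite eqf_sqr => /orP[|/eqP//] /eqP /CrealP s_real.
have := real_exprn_even_ge0 s_real (isT : ~~ odd 2).
by rewrite s2 oppr_ge0 lern0 => /eqP p0; rewrite p0 in p_gt0.
Qed.

Lemma quad_field_rat (p : nat) (a : rat) : quad_field p (ratr a).
Proof. by exists a, 0; rewrite raddf0 mul0r addr0. Qed.

Lemma quad_field_sub (p : nat) (x y : algC) :
  quad_field p x -> quad_field p y -> quad_field p (x - y).
Proof.
move=> [a [b ->]] [c [d ->]]; exists (a - c), (b - d).
by rewrite !rmorphB /=; ring.
Qed.

Lemma quad_field_mul (p : nat) (x y : algC) :
  quad_field p x -> quad_field p y -> quad_field p (x * y).
Proof.
move=> [a [b ->]] [c [d ->]]; exists (a * c - p%:R * (b * d)), (a * d + b * c).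
have s2 := sqrtCNn_sqr p; move: (sqrtC _) s2 => s s2.
rewrite rmorphB rmorphD /= !rmorphM /= rmorph_nat.
have -> : p%:R = - (s * s) by rewrite s2 opprK.
ring.
Qed.

Lemma quad_field_conj (p : nat) (a b : rat) : (0 < p)%N ->
  (ratr a + ratr b * sqrtC (- p%:R))^* = ratr a - ratr b * sqrtC (- p%:R) :> algC.
Proof.
move=> p_gt0; have := sqrtCNn_conj p_gt0; move: (sqrtC _) => s sJ.
by rewrite rmorphD [X in _ + X]rmorphM /= sJ !(fmorph_rat Num.conj) mulrN.
Qed.

Lemma quad_field_norm (p : nat) (a b : rat) :
  let s : algC := sqrtC (- p%:R) in
  (ratr a + ratr b * s) * (ratr a - ratr b * s) = ratr (a ^+ 2 + p%:R * b ^+ 2).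
Proof.
move=> s; rewrite rmorphD rmorphM /= !rmorphXn /= rmorph_nat.
have -> : p%:R = - (s * s) by rewrite sqrtCNn_sqr opprK.
ring.
Qed.

Lemma quad_field_div (p : nat) (x y : algC) : (0 < p)%N ->
  quad_field p x -> quad_field p y -> quad_field p (x / y).
Proof.
move=> p_gt0 Fx Fy; have [->|y0] := eqVneq y 0.
  by rewrite invr0 mulr0; exists 0, 0; rewrite !raddf0 mul0r addr0.
have -> : x / y = x * (y^* * (y * y^*)^-1).
  by rewrite invfM [y^* * _]mulrCA divff ?mulr1 ?conjC_eq0.
apply: quad_field_mul => //; case: Fy => a [b ->].
rewrite quad_field_conj //; set s := sqrtC _; apply: quad_field_mul.
  by exists a, (- b); rewrite rmorphN mulNr.
by rewrite quad_field_norm -fmorphV; exact: quad_field_rat.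
Qed.

(** Substituting ['X^2] in a monic integral polynomial of [x ^+ 2] gives one of [x]. *)
Lemma Aint_sqr (x : algC) : x ^+ 2 \in Aint -> x \in Aint.
Proof.
move=> x2_int; apply: (@root_monic_Aint (minCpoly (x ^+ 2) \Po 'X^2)).
- by rewrite /root horner_comp hornerXn; exact: root_minCpoly.
- rewrite monicE lead_coef_comp ?size_polyXn // lead_coefXn expr1n mulr1.
  exact: minCpoly_monic.
by apply: polyOver_comp; rewrite ?rpredX ?polyOverX.
Qed.

Lemma Aint_quadratic (x y : algC) :
  x + y \is a Num.int -> x * y \is a Num.int -> x \in Aint.
Proof.
move=> xDy xMy; apply: (@root_monic_Aint (('X - x%:P) * ('X - y%:P))).
- by rewrite rootM root_XsubC eqxx.
- by rewrite monicMl monicXsubC.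
have -> : ('X - x%:P) * ('X - y%:P) = 'X^2 - (x + y)%:P * 'X + (x * y)%:P.
  by rewrite polyCD polyCM; ring.
apply/polyOverP => i; rewrite coefD coefB coefXn coefCM coefX coefC.
by rewrite rpredD ?rpredB ?rpredM ?rpred_nat //; case: ifP => // _; rewrite rpred0.
Qed.

Lemma quad_int_sub (p : nat) (x y : algC) :
  quad_int p x -> quad_int p y -> quad_int p (x - y).
Proof.
by move=> [Fx Ix] [Fy Iy]; split; [exact: quad_field_sub|rewrite rpredB].
Qed.

Lemma quad_int_mul (p : nat) (x y : algC) :
  quad_int p x -> quad_int p y -> quad_int p (x * y).
Proof.
by move=> [Fx Ix] [Fy Iy]; split; [exact: quad_field_mul|rewrite rpredM].
Qed.

Lemma quad_int_int (p : nat) (z : int) : quad_int p z%:~R.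
Proof.
split; last exact: Aint_int.
by rewrite -[z%:~R](ratr_int algC); exact: quad_field_rat.
Qed.

Lemma quad_int0 (p : nat) : quad_int p 0. Proof. exact: (quad_int_int p 0). Qed.
Lemma quad_int1 (p : nat) : quad_int p 1. Proof. exact: (quad_int_int p 1). Qed.
Lemma quad_int2 (p : nat) : quad_int p 2. Proof. exact: (quad_int_int p 2). Qed.

Lemma quad_int_opp (p : nat) (x : algC) : quad_int p x -> quad_int p (- x).
Proof. by move/(quad_int_sub (quad_int0 p)); rewrite sub0r. Qed.

Lemma quad_int_add (p : nat) (x y : algC) :
  quad_int p x -> quad_int p y -> quad_int p (x + y).
Proof.
by move=> Ox /quad_int_opp Oy; rewrite -[y]opprK; exact: quad_int_sub.
Qed.

Lemma quad_int_exp (p : nat) (x : algC) (k : nat) :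
  quad_int p x -> quad_int p (x ^+ k).
Proof.
move=> Ox; elim: k => [|k IHk]; first by rewrite expr0; exact: quad_int1.
by rewrite exprS; exact: quad_int_mul.
Qed.

Lemma quad_int_conj (p : nat) (x : algC) : (0 < p)%N ->
  quad_int p x -> quad_int p x^*.
Proof.
move=> p_gt0 [[a [b ->]] Ix]; split; last by rewrite Aint_aut.
by rewrite quad_field_conj //; exists a, (- b); rewrite rmorphN mulNr.
Qed.

(** Trace and norm are rational algebraic integers, hence integers; conversely they are, up to sign,
    the coefficients of a monic quadratic with root [x]. *)
Lemma quad_int_traceP (p : nat) (x : algC) : (0 < p)%N -> quad_field p x ->
  quad_int p x <-> x + x^* \is a Num.int /\ x * x^* \is a Num.int.
Proof.
move=> p_gt0 Fx; split=> [Ox|[tr_int nm_int]]; last first.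
  by split=> //; exact: Aint_quadratic tr_int nm_int.
have [_ Itr] := quad_int_add Ox (quad_int_conj p_gt0 Ox).
have [_ Inm] := quad_int_mul Ox (quad_int_conj p_gt0 Ox).
case: Fx Itr Inm => a [b ->]; rewrite quad_field_conj //; set s := sqrtC _.
have -> : ratr a + ratr b * s + (ratr a - ratr b * s) = ratr (a + a).
  by rewrite rmorphD /=; ring.
by rewrite quad_field_norm => Itr Inm; split; apply: Cint_rat_Aint; rewrite ?Crat_rat.
Qed.

(** * Products and powers of ideals *)

Lemma ideal_prod_ideal (O I J : set algC) :
  is_ideal O O -> is_ideal O I -> is_ideal O J -> is_ideal O (ideal_prod I J).
Proof.
move=> O_id I_id J_id; split.
- move=> x [m [a [b [Ia Jb ->]]]]; elim/big_ind: _ => [|u v|i _].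
  + exact: ideal_0 O_id.
  + exact: (ideal_add O_id).
  by apply: (ideal_mulr O_id); [exact: (ideal_sub I_id)|exact: (ideal_sub J_id)].
- by exists 0%N, (fun=> 0), (fun=> 0); split; [case|case|rewrite big_ord0].
- move=> x y [m1 [a1 [b1 [Ia1 Jb1 ->]]]] [m2 [a2 [b2 [Ia2 Jb2 ->]]]].
  pose f (u1 : 'I_m1 -> algC) u2 (i : 'I_(m1 + m2)) :=
    match split i with inl j => u1 j | inr j => u2 j end.
  exists (m1 + m2)%N, (f a1 a2), (f b1 b2); rewrite /f.
  split=> [i|i|]; try by case: (split i).
  rewrite big_split_ord; congr (_ + _); apply: eq_bigr => i _.
    by rewrite (unsplitK (inl i)).
  by rewrite (unsplitK (inr i)).
move=> c x Oc [m [a [b [Ia Jb ->]]]].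
exists m, a, (fun i => c * b i); split=> // [i|]; first exact: (ideal_mulr J_id).
by rewrite big_distrr; apply: eq_bigr => i _; rewrite mulrCA.
Qed.

Lemma ideal_pow_ideal (O I : set algC) (k : nat) :
  is_ideal O O -> is_ideal O I -> is_ideal O (ideal_pow O I k).
Proof. by move=> O_id I_id; elim: k => //= k IHk; exact: ideal_prod_ideal. Qed.

Lemma ideal_prod_mem (I J : set algC) (x y : algC) :
  I x -> J y -> ideal_prod I J (x * y).
Proof.
by move=> Ix Jy; exists 1%N, (fun=> x), (fun=> y); rewrite big_ord1.
Qed.

Lemma ideal_pow_mem (O I : set algC) (x : algC) (k : nat) :
  O 1 -> I x -> ideal_pow O I k (x ^+ k).
Proof.
move=> O1 Ix; elim: k => [|k IHk]; first by rewrite expr0.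
by rewrite exprS; exact: ideal_prod_mem.
Qed.

Lemma quad_int_ideal (p : nat) : is_ideal (quad_int p) (quad_int p).
Proof.
by split=> //; [exact: quad_int0|exact: quad_int_add|exact: quad_int_mul].
Qed.

Lemma principal_same_class (O I : set algC) (b : algC) :
  O 1 -> O b -> b != 0 -> I `<=` [set b * y | y in O] ->
  [set b * y | y in O] `<=` I -> same_class O I O.
Proof.
move=> O1 Ob b0 sub1 sub2; exists 1, b; split; rewrite ?oner_eq0 //.
rewrite eqEsubset; split=> [x [y /sub1 Iy <-]|x /sub2 Ix]; first by rewrite mul1r.
by exists x => //; rewrite mul1r.
Qed.

(** The generator is b / a, which lies in [I] because b belongs to b O = a I. *)
Lemma same_class_principal (O I : set algC) : is_ideal O I -> O 1 ->
  same_class O I O ->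
  exists c, [/\ I c, c != 0 & I `<=` [set c * y | y in O]].
Proof.
move=> I_id O1 [a [b [Oa Ob a0 b0 eq_ab]]].
have [c Ic acb] : [set a * x | x in I] b by rewrite eq_ab; exists 1; rewrite ?mulr1.
exists c; split=> // [|x Ix].
  by apply: contraNneq b0 => c0; rewrite -acb c0 mulr0.
have [y Oy byax] : [set b * y | y in O] (a * x) by rewrite -eq_ab; exists x.
by exists y => //; apply: (mulfI a0); rewrite mulrA acb.
Qed.

(** * The primes above 2 *)

(** The norm is (1 + p) / 4; it is even because 8 divides [p.+1], so a prime above 2 contains [om]
    or its conjugate. *)
Lemma quad_int_half (p r : nat) : p.+1 = (8 * r)%N ->
  let om : algC := (1 + sqrtC (- p%:R)) / 2 in
  [/\ quad_int p om, om + om^* = 1 & om * om^* = (2 * r)%:R].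
Proof.
move=> pE om; have p_gt0 : (0 < p)%N by lia.
have omJ : om^* = (1 - sqrtC (- p%:R)) / 2.
  rewrite /om; have := sqrtCNn_conj p_gt0; move: (sqrtC _) => s sJ.
  by rewrite fmorph_div rmorphD rmorph1 rmorph_nat /= sJ.
have tr_om : om + om^* = 1 by rewrite omJ /om; field.
have nm_om : om * om^* = (2 * r)%:R.
  rewrite omJ /om; have := sqrtCNn_sqr p; move: (sqrtC _) => s s2.
  have -> : (1 + s) / 2 * ((1 - s) / 2) = (1 - s * s) / 4 by field.
  by rewrite s2 opprK nat1r pE !natrM; field.
split=> //; apply/quad_int_traceP => //.
  by exists (2^-1), (2^-1); rewrite fmorphV rmorph_nat /om; field.
by rewrite tr_om nm_om rpred1 rpred_nat.
Qed.

(* The data attached to a prime above a split [2]: [t] plays the role of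
   (1 + sqrt(-p))/2 or of its conjugate, whichever belongs to [P]. *)
Record split_prime2 (p : nat) (P : set algC) (t : algC) : Prop := SplitPrime2 {
  split_gt0 : (0 < p)%N;
  split_prime : is_prime_ideal (quad_int p) P;
  split_above : lies_above P 2;
  split_mem : P t;
  split_trace : t + t^* = 1;
  split_norm : exists r : nat, t * t^* = (2 * r)%:R }.

Lemma split_prime2_exists (p r : nat) (P : set algC) : p.+1 = (8 * r)%N ->
  is_prime_ideal (quad_int p) P -> lies_above P 2 ->
  exists t, split_prime2 p P t.
Proof.
move=> pE P_prime P_above; have p_gt0 : (0 < p)%N by lia.
have [Oom tr_om nm_om] := quad_int_half pE.
move: ((1 + _) / 2) Oom tr_om nm_om => om Oom tr_om nm_om.
have [Pom|Pom] : P om \/ P om^*.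
  apply: (prime_ideal_mul P_prime) => //; first exact: quad_int_conj.
  by rewrite nm_om; apply/(P_above (2 * r)%N); rewrite dvdzE dvdn_mulr.
- by exists om; split=> //; exists r.
exists om^*; split=> //; rewrite conjCK; first by rewrite addrC.
by exists r; rewrite mulrC.
Qed.

(** * Powers of a prime above 2 *)

Section SplitPrime.

Context (p : nat) (P : set algC) (t : algC) (Pt : split_prime2 p P t).

Let O := quad_int p.
Let p_gt0 := split_gt0 Pt.
Let P_ideal : is_ideal O P := prime_ideal_ideal (split_prime Pt).
Let Ot : O t := ideal_sub P_ideal (split_mem Pt).
Let Ot' : O t^* := quad_int_conj p_gt0 Ot.

Lemma split_not_mem1 : ~ P 1.
Proof. by move/(split_above Pt 1). Qed.

Lemma split_mem2 : P 2.
Proof. exact/(split_above Pt 2). Qed.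

Lemma split_pow_ideal (k : nat) : is_ideal O (ideal_pow O P k).
Proof. exact: (ideal_pow_ideal k (quad_int_ideal p) P_ideal). Qed.

Lemma split_even (x : algC) : P x -> x \is a Num.int -> x / 2 \is a Num.int.
Proof.
move=> Px /intrP[z xE]; move: Px; rewrite xE => /(split_above Pt)/dvdzP[y ->].
by rewrite intrM mulfK ?pnatr_eq0 ?intr_int.
Qed.

(** The trace of [t^* * x] lies in [P], since [x] and [t] do, so it is even. The norm is [2 * r]
    times that of [x], which is in [P] and thus even too. Hence the half has integral trace and
    norm. *)
Lemma conj_mul_half (x : algC) : P x -> O (t^* * x / 2).
Proof.
move=> Px; have Ox : O x := ideal_sub P_ideal Px.
have Oy : O (t^* * x) by exact: quad_int_mul.
apply/quad_int_traceP => //.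
  apply: quad_field_div => //; first by case: Oy.
  by have [] := quad_int2 p.
have Ox' := quad_int_conj p_gt0 Ox.
have yJ : (t^* * x)^* = t * x^* by rewrite rmorphM /= conjCK.
have -> : (t^* * x / 2)^* = t * x^* / 2 by rewrite fmorph_div rmorph_nat /= yJ.
have [tr_int nm_int] := (quad_int_traceP p_gt0 Oy.1).1 Oy.
rewrite yJ in tr_int nm_int; split.
  rewrite -mulrDl; apply: split_even => //; apply: (ideal_add P_ideal).
    exact: (ideal_mulr P_ideal).
  by rewrite mulrC; apply: (ideal_mulr P_ideal) => //; exact: (split_mem Pt).
have [r tt'] := split_norm Pt.
have -> : t^* * x / 2 * (t * x^* / 2) = r%:R * (x * x^* / 2).
  transitivity ((t * t^*) * (x * x^*) / 4); first by field.
  by rewrite tt' natrM; field.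
rewrite rpredM ?rpred_nat //; apply: split_even.
  by rewrite mulrC; exact: (ideal_mulr P_ideal).
by have [] := (quad_int_traceP p_gt0 Ox.1).1 Ox.
Qed.

(** The relation [t + t^* = 1] makes [t] and [t^*] comaximal, and this passes to powers on either
    side. *)
Lemma comaximal_exp (k : nat) :
  exists u v, [/\ O u, O v & u * t ^+ k + v * t^* ^+ k = 1].
Proof.
pose C x y := exists u v, [/\ O u, O v & u * x + v * y = 1].
(* The Bezout relations for [y] and for [z] are multiplied together. *)
have CM x y z : O x -> O y -> O z -> C x y -> C x z -> C x (y * z).
  move=> Ox Oy Oz [u [v [Ou Ov uv1]]] [u' [v' [Ou' Ov' uv1']]].
  exists (u * (u' * x + v' * z) + v * y * u'), (v * v'); split.
  - rewrite uv1' mulr1; apply: quad_int_add => //.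
    by apply: quad_int_mul => //; exact: quad_int_mul.
  - exact: quad_int_mul.
  by rewrite -[RHS]mulr1 -{1}uv1 -uv1'; ring.
have CX x y j : O x -> O y -> C x y -> C x (y ^+ j).
  move=> Ox Oy Cxy; elim: j => [|j IHj].
    exists 0, 1; split; [exact: quad_int0|exact: quad_int1|].
    by rewrite expr0 mul0r add0r mulr1.
  by rewrite exprS; apply: CM => //; exact: quad_int_exp.
have Csym x y : C x y -> C y x.
  by case=> u [v [Ou Ov uv1]]; exists v, u; split; rewrite // addrC.
apply: (CX); [exact: quad_int_exp|exact: Ot'|].
apply: (Csym); apply: (CX) => //; exists 1, 1.
by rewrite !mul1r addrC (split_trace Pt); split=> //; exact: quad_int1.
Qed.

(* Since [t^*] lies in the conjugate of [P] but not in [P], the right-hand side says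
   that [x] has valuation at least [k] at [P]. *)
Lemma ideal_powP (k : nat) (x : algC) :
  ideal_pow O P k x <-> O x /\ O (t^* ^+ k * x / 2 ^+ k).
Proof.
have P_id := split_pow_ideal.
split=> [Px|[Ox Oy]].
  split; first exact: (ideal_sub (P_id k)).
  (* Each factor taken from [P] absorbs one [t^* / 2]. *)
  elim: k x Px => [|k IHk] x; first by rewrite !expr0 mul1r divr1.
  case=> m [a [b [Pa Pb ->]]]; rewrite mulr_sumr mulr_suml.
  elim/big_ind: _ => [|u v|i _]; [exact: quad_int0|exact: quad_int_add|].
  have -> : t^* ^+ k.+1 * (a i * b i) / 2 ^+ k.+1 =
      (t^* * a i / 2) * (t^* ^+ k * b i / 2 ^+ k).
    by rewrite !exprS invfM; ring.
  by apply: quad_int_mul; [exact: conj_mul_half|apply: IHk; exact: Pb].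
have [u [v [Ou Ov uv1]]] := comaximal_exp k.
(* The Bezout relation times [x]: one term is a multiple of [t ^+ k], the other of [2 ^+ k]. *)
have -> : x = u * x * t ^+ k + v * (t^* ^+ k * x / 2 ^+ k) * 2 ^+ k.
  rewrite -[X in _ = _ + X]mulrA divfK ?expf_neq0 ?pnatr_eq0 //.
  rewrite -[LHS]mul1r -[X in X * _]uv1. ring.
have O1 := quad_int1 p.
apply: (ideal_add (P_id k)); apply: (ideal_mulr (P_id k)).
- exact: quad_int_mul.
- exact: (ideal_pow_mem k O1 (split_mem Pt)).
- exact: quad_int_mul.
exact: (ideal_pow_mem k O1 split_mem2).
Qed.

(** In the ring of integers [c * c^*] and [2 ^+ n] divide each other; the quotients are rational,
    hence integers, and positivity leaves only 1. *)
Lemma ideal_pow_gen_norm (n : nat) (c : algC) : ideal_pow O P n c -> c != 0 ->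
  ideal_pow O P n `<=` [set c * y | y in O] -> c * c^* = 2 ^+ n.
Proof.
move=> /ideal_powP[Oc Oe] c0 c_gen.
have O1 := quad_int1 p; have Oc' := quad_int_conj p_gt0 Oc.
have [d Od cd] := c_gen _ (ideal_pow_mem n O1 split_mem2).
have [g Og cg] := c_gen _ (ideal_pow_mem n O1 (split_mem Pt)).
have [u [v [Ou Ov uv1]]] := comaximal_exp n.
have pow2_neq0 : 2 ^+ n != 0 :> algC by rewrite expf_neq0 ?pnatr_eq0.
have cc0 : c * c^* != 0 by rewrite mulf_neq0 ?conjC_eq0.
have cJ (x : algC) : O x -> O x^* := @quad_int_conj p x p_gt0.
have OM x y : O x -> O y -> O (x * y) := @quad_int_mul p x y.
have OD x y : O x -> O y -> O (x + y) := @quad_int_add p x y.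
have uv1J : u^* * t^* ^+ n + v^* * t ^+ n = 1.
  by rewrite -(rmorph1 Num.conj) -uv1 rmorphD !rmorphM !rmorphXn /= conjCK.
have cdJ : c^* * d^* = 2 ^+ n by rewrite -rmorphM cd rmorphXn rmorph_nat.
have cgJ : c^* * g^* = t^* ^+ n by rewrite -rmorphM cg rmorphXn.
pose e := t^* ^+ n * c / 2 ^+ n.
have eJ : e^* = t ^+ n * c^* / 2 ^+ n.
  by rewrite /e fmorph_div rmorphM !rmorphXn /= conjCK rmorph_nat.
have O_quot1 : O (c * c^* / 2 ^+ n).
  (* The conjugate Bezout relation splits the quotient into multiples of the integers [e] and
     [e^*]. *)
  have -> : c * c^* / 2 ^+ n = u^* * e * c^* + c * v^* * e^*.
    by rewrite eJ /e -[c * c^*]mulr1 -{1}uv1J; ring.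
  exact: OD (OM _ _ (OM _ _ (cJ _ Ou) Oe) Oc') (OM _ _ (OM _ _ Oc (cJ _ Ov)) (cJ _ Oe)).
have O_quot2 : O (2 ^+ n / (c * c^*)).
  (* Multiply the Bezout relation by [2 ^+ n]: in each term one factor is a multiple of [c] and the
     other of its conjugate. *)
  have -> : 2 ^+ n / (c * c^*) = u * g * d^* + v * g^* * d.
    apply: (mulIf cc0); rewrite divfK //.
    transitivity (u * (c * g) * (c^* * d^* ) + v * (c^* * g^* ) * (c * d)).
      by rewrite cg cgJ cd cdJ -mulrDl uv1 mul1r.
    ring.
  exact: OD (OM _ _ (OM _ _ Ou Og) (cJ _ Od)) (OM _ _ (OM _ _ Ov (cJ _ Og)) Od).
have c_nm_int : c * c^* \is a Num.int.
  by have [] := (quad_int_traceP p_gt0 Oc.1).1 Oc.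
have c_rat : c * c^* \in Crat.
  by have /intrP[z ->] := c_nm_int; rewrite -(ratr_int algC) Crat_rat.
have pow2_rat : (2 ^+ n : algC) \in Crat.
  by rewrite -(rmorph_nat (ratr : rat -> algC)) -rmorphXn Crat_rat.
have /intrP[k1 k1E] : c * c^* / 2 ^+ n \is a Num.int.
  by apply: Cint_rat_Aint; [rewrite rpred_div|case: O_quot1].
have /intrP[k2 k2E] : 2 ^+ n / (c * c^*) \is a Num.int.
  by apply: Cint_rat_Aint; [rewrite rpred_div|case: O_quot2].
have k12 : k1 * k2 = 1.
  apply: (@intr_inj algC); rewrite intrM -k1E -k2E.
  by rewrite mulrA divfK // divff.
have k1_ge0 : 0 <= k1.
  by rewrite -(ler0z algC) -k1E divr_ge0 ?mul_conjC_ge0 ?exprn_ge0.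
have k1_1 : k1 = 1.
  have /eqP : (`|k1| * `|k2| = 1)%N by rewrite -abszM k12.
  rewrite muln_eq1 => /andP[/eqP k1N _]; lia.
by rewrite -[LHS](divfK pow2_neq0) k1E k1_1 mul1r.
Qed.

(** If 2 divided [c], it would divide [t ^+ n] and its conjugate; by primality [t^*] would be in
    [P], and so would [1 = t + t^*]. *)
Lemma ideal_pow_gen_half (n : nat) (c : algC) :
  ideal_pow O P n `<=` [set c * y | y in O] -> ~ O (c / 2).
Proof.
move=> c_gen Oh; have O1 := quad_int1 p.
have [g Og cg] := c_gen _ (ideal_pow_mem n O1 (split_mem Pt)).
have Ptn : P (t^* ^+ n).
  rewrite -rmorphXn /= -cg.
  have -> : c * g = (c / 2 * g) * 2 by field.
  rewrite rmorphM rmorph_nat /=; apply: (ideal_mulr P_ideal).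
    by apply: quad_int_conj => //; exact: quad_int_mul.
  exact: split_mem2.
have {Ptn} Pt' : P t^*.
  elim: n Ptn {c_gen cg} => [|k IHk]; first by rewrite expr0 => /split_not_mem1.
  rewrite exprS; case/(prime_ideal_mul (split_prime Pt)) => //.
  exact: quad_int_exp.
apply: split_not_mem1; rewrite -(split_trace Pt).
by apply: (ideal_add P_ideal); first exact: (split_mem Pt).
Qed.

(* [O] being integrally closed, [b] divides [x] as soon as [b ^+ 2] divides
   [x ^+ 2]. *)
Lemma ideal_pow_sqrt (m : nat) (b c : algC) : O b -> b != 0 ->
  b ^+ 2 = c \/ b ^+ 2 = - c ->
  ideal_pow O P (2 * m) c -> ideal_pow O P (2 * m) `<=` [set c * y | y in O] ->
  same_class O (ideal_pow O P m) O.
Proof.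
move=> Ob b0 b2 Pc c_gen; have O1 := quad_int1 p.
have O_sqrt x y : O x -> O y -> O ((x / y) ^+ 2) -> O (x / y).
  move=> [Fx _] [Fy _] [_ Ixy]; split; first exact: quad_field_div.
  exact: Aint_sqr.
have O2m : O (2 ^+ m) by apply: quad_int_exp; exact: quad_int2.
have Otm : O (t^* ^+ m) by apply: quad_int_exp.
have P_id := split_pow_ideal m.
(* The quotient to be shown integral has as its square, up to sign, the corresponding quotient for
   [c]. *)
have Pb : ideal_pow O P m b.
  apply/ideal_powP; split=> //; apply: O_sqrt => //; first exact: quad_int_mul.
  have [_] := (ideal_powP _ _).1 Pc.
  rewrite expr_div_n exprMn -!exprM [(m * 2)%N]mulnC.
  case: b2 => -> //; rewrite mulrN mulNr; exact: quad_int_opp.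
apply: (principal_same_class O1 Ob b0) => [x Px|_ [y Oy <-]]; last first.
  by rewrite mulrC; exact: (ideal_mulr P_id).
have [Ox Oxt] := (ideal_powP _ _).1 Px.
have Px2 : ideal_pow O P (2 * m) (x ^+ 2).
  apply/ideal_powP; split; first exact: quad_int_exp.
  have -> : t^* ^+ (2 * m) * x ^+ 2 / 2 ^+ (2 * m) =
      (t^* ^+ m * x / 2 ^+ m) ^+ 2.
    by rewrite expr_div_n exprMn -!exprM [(m * 2)%N]mulnC.
  exact: quad_int_exp.
have [z Oz cz] := c_gen _ Px2.
exists (x / b); last by rewrite mulrC divfK.
(* Up to sign [(x / b) ^+ 2] is [x ^+ 2 / c], which equals the integer [z]. *)
apply: O_sqrt => //; rewrite expr_div_n -cz.
have c0 : c != 0 by apply: contraNneq b0 => c0; case: b2 => /eqP;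
  rewrite c0 ?oppr0 expf_eq0.
case: b2 => ->; first by rewrite mulrC mulKf.
by rewrite invrN mulrN [c * z]mulrC mulfK //; exact: quad_int_opp.
Qed.

End SplitPrime.

(** * Oddness of the class order *)

(** The rational [p * b] has an integral square, so it is an integer [y]; then [p] divides [y ^ 2],
    hence [y]. *)
Lemma prime_sqr_int (p : nat) (b : rat) : prime p ->
  p%:R * b ^+ 2 \is a Num.int -> b \is a Num.int.
Proof.
move=> p_prime /intrP[k kE]; have p_gt0 := prime_gt0 p_prime.
have p_neq0 : p%:R != 0 :> rat by rewrite pnatr_eq0 -lt0n.
have sqrE : (p%:R * b) ^+ 2 = (p%:Z * k)%:~R.
  by rewrite intrM -kE -[p%:Z%:~R]/(p%:R); ring.
have /intrP[y yE] : p%:R * b \is a Num.int.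
  suff : ratr (p%:R * b) \is a (@Num.int algC).
    case/intrP=> z zE; apply/intrP; exists z.
    by apply: (fmorph_inj (ratr : rat -> algC)); rewrite /= zE ratr_int.
  apply: Cint_rat_Aint; first exact: Crat_rat.
  by apply: Aint_sqr; rewrite -rmorphXn /= sqrE ratr_int Aint_int.
have y2 : y ^+ 2 = p%:Z * k.
  by apply: (@intr_inj rat); rewrite rmorphXn /= -yE sqrE.
have : (p %| `|y| ^ 2)%N by rewrite -abszX y2 abszM dvdn_mulr.
rewrite Euclid_dvdX // andbT -[(p %| _)%N]/(p%:Z %| y)%Z => /dvdzP[z zE].
apply/intrP; exists z; apply: (mulfI p_neq0).
by rewrite yE zE intrM mulrC.
Qed.

Lemma class_order_odd (p r : nat) (P : set algC) (n : nat) :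
  prime p -> p.+1 = (8 * r)%N -> is_prime_ideal (quad_int p) P ->
  lies_above P 2 -> is_class_order (quad_int p) P n -> odd n.
Proof.
move=> p_prime pE P_prime P_above [n_gt0 Pn_principal n_min].
have p_gt0 := prime_gt0 p_prime.
have [t Pt] := split_prime2_exists pE P_prime P_above.
apply: contraT => n_even; pose m := n./2.
have nE : n = (2 * m)%N by rewrite mul2n even_halfK.
have m_gt0 : (0 < m)%N by lia.
(* This contradicts the minimality of [n = 2 * m]. *)
suff : same_class (quad_int p) (ideal_pow (quad_int p) P m) (quad_int p).
  by case/n_min; lia.
have [c [Pc c0 c_gen]] :=
  same_class_principal (split_pow_ideal Pt n) (quad_int1 p) Pn_principal.
have nm_c := ideal_pow_gen_norm Pt Pc c0 c_gen.
have half_c := ideal_pow_gen_half Pt c_gen.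
have Oc := ideal_sub (split_pow_ideal Pt n) Pc.
have [a [b cE]] := Oc.1.
set s := sqrtC _ in cE.
have cJ : c^* = ratr a - ratr b * s by rewrite cE quad_field_conj.
have s2 : s * s = - p%:R := sqrtCNn_sqr p.
have /intrP[x xE] : c + c^* \is a Num.int.
  by have [] := (quad_int_traceP p_gt0 Oc.1).1 Oc.
have aE : a + a = x%:~R.
  apply: (fmorph_inj (ratr : rat -> algC)); rewrite /= ratr_int -xE cJ cE rmorphD.
  by rewrite addrACA subrr addr0.
have nm_ab : a ^+ 2 + p%:R * b ^+ 2 = 2 ^+ n.
  apply: (fmorph_inj (ratr : rat -> algC)); rewrite /= rmorphXn rmorph_nat -nm_c.
  by rewrite cJ cE quad_field_norm.
(* With [x] the trace [2 * a], this writes [c] as (x + y s) / 2. *)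
have /intrP[y yE] : b + b \is a Num.int.
  apply: (prime_sqr_int p_prime).
  have -> : p%:R * (b + b) ^+ 2 = 4 * 2 ^+ n - x%:~R ^+ 2.
    by rewrite -aE -nm_ab; ring.
  by rewrite rpredB ?rpredM ?rpredX ?rpred_nat ?intr_int.
(* For even [x], [c / 2] would have integral trace and norm 2^(n-2), hence be integral. *)
have x_odd : ~~ (2 %| x)%Z.
  apply/negP => /dvdzP[z xz]; apply: half_c; apply/quad_int_traceP => //.
    by apply: quad_field_div => //; [exact: Oc.1|exact: (quad_int2 p).1].
  rewrite fmorph_div rmorph_nat /= -mulrDl xE xz intrM mulfK ?pnatr_eq0 //.
  rewrite intr_int mulf_div nm_c nE (_ : (2 * m = 2 + 2 * m.-1)%N); last by lia.
  by rewrite exprD expr2 mulrC mulKf ?mulf_neq0 ?pnatr_eq0 // rpredX ?rpred_nat.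
have xyE : x ^+ 2 + p%:Z * y ^+ 2 = 2 ^+ (2 * m.+1).
  apply: (@intr_inj rat); rewrite rmorphD rmorphM !rmorphXn /= -aE -yE.
  rewrite -[p%:Z%:~R]/(p%:R) -[2%:~R]/(2%:R) mulnS exprD -nE -nm_ab; ring.
have [u [v [uvE sqrE]]] := norm_eq_even_pow2 p_prime x_odd xyE.
have c2E : 2 * c = x%:~R + y%:~R * s.
  by rewrite -!(ratr_int algC) -aE -yE cE !rmorphD /=; ring.
(* The square root of [c] up to sign; it is integral, with trace [u] and norm [2 ^+ m]. *)
pose d : algC := (u%:~R + v%:~R * s) / 2.
have dE : d = ratr (u%:~R / 2) + ratr (v%:~R / 2) * s.
  by rewrite !fmorph_div /= !ratr_int !rmorph_nat /d; field.
have Fd : quad_field p d by rewrite dE; exists (u%:~R / 2), (v%:~R / 2).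
have dJ : d^* = (u%:~R - v%:~R * s) / 2.
  by rewrite dE quad_field_conj // -/s !fmorph_div /= !ratr_int !rmorph_nat; field.
have nm_d : d * d^* = 2 ^+ m.
  have : (u ^+ 2 + p%:Z * v ^+ 2)%:~R = (2 ^+ m.+2)%:~R :> algC by rewrite uvE.
  rewrite rmorphD rmorphM !rmorphXn /= -[p%:Z%:~R]/(p%:R) -[2%:~R]/(2%:R).
  have -> : p%:R = - (s * s) by rewrite s2 opprK.
  rewrite !exprS => uv2; apply: (mulfI (_ : 4 != 0)); first by rewrite pnatr_eq0.
  have -> : 4 * 2 ^+ m = 2 * (2 * 2 ^+ m) :> algC by ring.
  by rewrite -uv2 dJ /d; field.
have Od : quad_int p d.
  apply/quad_int_traceP => //; rewrite nm_d dJ; split.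
    by rewrite (_ : d + _ = u%:~R) ?intr_int // /d; field.
  by rewrite rpredX ?rpred_nat.
have d0 : d != 0.
  apply: contra_eq_neq nm_d => ->.
  by rewrite mul0r eq_sym expf_neq0 ?pnatr_eq0.
have d2 : d ^+ 2 = c \/ d ^+ 2 = - c.
  have d2E : 4 * d ^+ 2 = (u ^+ 2 - p%:Z * v ^+ 2)%:~R + 2 * (u * v)%:~R * s.
    rewrite rmorphB !rmorphM /= -[p%:Z%:~R]/(p%:R).
    have -> : p%:R = - (s * s) by rewrite s2 opprK.
    by rewrite /d; field.
  have n4 : 4 != 0 :> algC by rewrite pnatr_eq0.
  case: sqrE d2E => -[-> ->] d2E; [left|right]; apply: (mulfI n4); rewrite d2E.
    have -> : 4 * c = 2 * (2 * c) by ring.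
    by rewrite c2E intrM; ring.
  have -> : 4 * - c = - (2 * (2 * c)) by ring.
  by rewrite c2E !rmorphN /= intrM; ring.
rewrite nE in Pc c_gen.
exact: (@ideal_pow_sqrt _ _ _ Pt m d c).
Qed.

(** * Distances in the folded component *)

(** An edge lowers [f] by at most one, which bounds path lengths from below; descending edges lead
    to [w] in exactly [f v] steps. *)
Lemma graph_dist_potential (T : finType) (e : rel T) (w : T) (f : T -> nat) :
  f w = 0%N -> (forall u v, e u v -> (f u <= (f v).+1)%N) ->
  (forall u, u != w -> exists2 v, e u v & f u = (f v).+1) ->
  forall v, graph_dist e v w = f v.
Proof.
move=> fw0 f_lip f_desc v.
have lower s u : path e u s -> last u s = w -> (f u <= size s)%N.
  elim: s u => [|t s IHs] u /=; first by move=> _ ->; rewrite fw0.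
  case/andP=> e_ut path_s last_s; apply: leq_trans (f_lip _ _ e_ut) _.
  by rewrite ltnS IHs.
(* The strict decrease of [f] along the path makes its vertices distinct. *)
have upper k u : f u = k -> exists s, [/\ size s = k, path e u s,
    last u s = w, uniq (u :: s) & all (fun t => f t < f u)%N s].
  elim: k u => [|k IHk] u fu.
    exists [::]; split=> //=; apply/eqP; apply: contraTT isT => /f_desc[? _].
    by rewrite fu.
  have [|t e_ut fut] := f_desc u.
    by apply: contraPneq fu => ->; rewrite fw0.
  have [|s [sz_s path_s last_s uniq_s lt_s]] := IHk t; first by lia.
  have lt_ts : all (fun t => f t < f u)%N (t :: s).
    rewrite /= fut ltnSn; apply: sub_all lt_s => z; lia.
  exists (t :: s); split; rewrite ?lt_ts //= ?sz_s ?e_ut //.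
  by rewrite -[_ && uniq s]/(uniq (t :: s)) uniq_s andbT; apply/negP;
     move/(allP lt_ts); rewrite ltnn.
have [s [sz_s path_s last_s uniq_s _]] := upper _ v erefl.
(* The search in [graph_dist] only covers lengths below [#|T|]. *)
have fv_lt : (f v < #|T|)%N.
  by rewrite -sz_s -[X in (X <= _)%N]/(size (v :: s)) -(card_uniqP uniq_s) max_card.
rewrite /graph_dist; set a := (X in find X).
have a_fv : a (f v).
  apply/existsP; exists (Tuple (introT eqP sz_s)) => /=.
  by rewrite path_s last_s eqxx andbT -[_ && _]/(uniq (v :: s)) uniq_s.
have has_a : has a (iota 0 #|T|).
  by apply/hasP; exists (f v); rewrite ?mem_iota.
apply/eqP; rewrite eqn_leq; apply/andP; split.
  rewrite leqNgt; apply/negP => /(before_find 0%N).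
  by rewrite nth_iota // add0n a_fv.
have := nth_find 0%N has_a; rewrite nth_iota ?add0n; last first.
  by rewrite -[X in (_ < X)%N](size_iota 0) -has_find.
case/existsP=> t /and3P[path_t _ /eqP last_t].
by have := lower _ _ path_t last_t; rewrite size_tuple.
Qed.

(* Position on the path 1, 3, 5, ... of an odd vertex, or of the odd neighbour of
   an even one: 2k + 1 and 2k + 2 are sent to k, and the leaf 0 to 0. *)
Definition spine_pos (v : nat) : nat := v.-1./2.

Lemma spine_pos_odd (v : nat) : odd v -> v = (2 * spine_pos v).+1.
Proof. by rewrite /spine_pos; lia. Qed.

Lemma spine_pos_even (v : nat) : ~~ odd v -> v != 0%N -> v = (2 * spine_pos v).+2.
Proof. by rewrite /spine_pos; case: v => // v v_odd _; lia. Qed.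

Lemma folded_adj_spine (n : nat) (v w : 'I_n) : odd n ->
  odd v -> odd w -> spine_pos w = (spine_pos v).+1 ->
  folded_adj v w /\ folded_adj w v.
Proof.
move=> n_odd /spine_pos_odd vE /spine_pos_odd wE pos_w.
have w_lt := ltn_ord w; rewrite wE pos_w in w_lt.
have lt_n : ((spine_pos v).+1 < n)%N by lia.
(* Here [w = 2 * spine_pos v + 3 < n], and the odd [n] cannot be the even number just after [w]. *)
have bound : (2 * (spine_pos v).+1 + 3 <= n)%N by lia.
have e1 : (2 * (spine_pos v).+1 - 1)%N = v by lia.
have e2 : (2 * (spine_pos v).+1 + 1)%N = w by lia.
split; apply/or3P; apply: Or31; apply/existsP; exists (Ordinal lt_n);
  by rewrite /= bound /unordered_eq e1 e2 !eqxx ?orbT.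
Qed.

Lemma folded_adj_leaf (n : nat) (v w : 'I_n) : odd n ->
  odd v -> ~~ odd w -> spine_pos w = spine_pos v ->
  folded_adj v w /\ folded_adj w v.
Proof.
move=> n_odd v_odd w_even pos_w.
have vE := spine_pos_odd v_odd.
have [w0|w_gt0] := posnP w.
  have v1 : v = 1%N :> nat by rewrite vE -pos_w w0.
  by split; apply/or3P; apply: Or33; rewrite /unordered_eq w0 v1.
have wE : (2 * spine_pos v + 2)%N = w by rewrite -pos_w /spine_pos; lia.
have w_lt := ltn_ord w; rewrite -wE in w_lt.
have lt_n : (spine_pos v < n)%N by lia.
have bound : (2 * spine_pos v + 3 <= n)%N by lia.
have e1 : (2 * spine_pos v + 1)%N = v by rewrite addn1.
split; apply/or3P; apply: Or32; apply/existsP; exists (Ordinal lt_n);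
  by rewrite /= bound /unordered_eq e1 wE !eqxx ?orbT.
Qed.

Lemma folded_adj_pos (n : nat) (v w : 'I_n) : folded_adj v w ->
  [/\ odd v, odd w & spine_pos v = (spine_pos w).+1 \/
                     spine_pos w = (spine_pos v).+1]
  \/ spine_pos v = spine_pos w /\ odd v = ~~ odd w.
Proof.
have pos1 k : spine_pos (2 * k + 1) = k by rewrite /spine_pos; lia.
have pos2 k : spine_pos (2 * k + 2) = k by rewrite /spine_pos; lia.
have odd1 k : odd (2 * k + 1) by lia.
have odd2 k : odd (2 * k + 2) = false by lia.
case/or3P=> [/existsP[k]|/existsP[k]|].
(* Since [1 <= k], writing [k] as [j.+1] removes the truncated subtraction. *)
- case/and3P; case: (nat_of_ord k) => // j _ _.
  have -> : (2 * j.+1 - 1 = 2 * j + 1)%N by lia.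
  by case/orP=> /andP[/eqP -> /eqP ->]; left; rewrite !pos1; split=> //; auto.
- case/andP=> _ /orP[] /andP[/eqP -> /eqP ->]; right;
    by rewrite pos1 pos2 odd1 odd2.
by case/orP=> /andP[/eqP -> /eqP ->]; right.
Qed.

(** The distance of the positions on the spine, as a sum of truncated differences, plus one edge for
    each even end, which is a leaf. Without the separate case an even vertex would be at distance 2
    from itself. *)
Definition folded_dist (v w : nat) : nat :=
  if v == w then 0%N
  else ((spine_pos v - spine_pos w) + (spine_pos w - spine_pos v)
       + ~~ odd v + ~~ odd w)%N.

Lemma folded_distC (v w : nat) : folded_dist v w = folded_dist w v.
Proof.
rewrite /folded_dist eq_sym; case: eqP => // _.
by rewrite addnAC [(_ - _ + _)%N]addnC.
Qed.

(** The potential is [folded_dist] to [w]. Descent goes from a leaf to the spine, along the spine to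
    the position of [w], then onto [w] if it is a leaf. *)
Lemma graph_dist_folded (n : nat) (v w : 'I_n) : odd n ->
  graph_dist (@folded_adj n) v w = folded_dist v w.
Proof.
move=> n_odd.
apply: (@graph_dist_potential _ _ w (fun u : 'I_n => folded_dist u w)).
- by rewrite /folded_dist eqxx.
- move=> a b /folded_adj_pos adj_ab; rewrite /folded_dist.
  case: (nat_of_ord a =P w) => // _; case: (nat_of_ord b =P w) => [<-|_].
    case: adj_ab => [[-> -> [] ->]|[-> ->]]; rewrite ?addn0 ?subnn ?negbK.
    + by rewrite subSnn; lia.
    + by rewrite subSnn; lia.
    by case: (odd b).
  by case: adj_ab => [[-> -> [] ->]|[-> ->]]; rewrite /= ?negbK;
    [lia|lia|case: (odd b); lia].
move=> u u_neq_w; have {}u_neq_w : u <> w :> nat by apply/eqP.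
have w_lt := ltn_ord w; have u_lt := ltn_ord u.
have odd_S2 k : odd (2 * k).+1 by rewrite oddS mul2n odd_double.
rewrite /folded_dist (introF eqP u_neq_w).
have [u_odd|u_even] := boolP (odd u); last first.
  (* For [u = 0] this says [1 < n], which holds because [w] is a second vertex. *)
  have t_lt : ((2 * spine_pos u).+1 < n)%N.
    by rewrite /spine_pos; lia.
  pose t := Ordinal t_lt.
  have t_odd : odd t := odd_S2 _.
  have pos_t : spine_pos u = spine_pos t by rewrite [RHS]/spine_pos /=; lia.
  exists t; first by case: (folded_adj_leaf n_odd t_odd u_even pos_t).
  rewrite t_odd -pos_t; case: (nat_of_ord t =P w) => [<-|_].
    by rewrite t_odd -pos_t subnn.
  by rewrite /= addn0 addn1 addSn.
have uE := spine_pos_odd u_odd.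
have [lt_uw|gt_uw|eq_uw] := ltngtP (spine_pos u) (spine_pos w).
- have t_lt : ((2 * (spine_pos u).+1).+1 < n)%N.
    by move: lt_uw; rewrite /spine_pos; lia.
  pose t := Ordinal t_lt.
  have t_odd : odd t := odd_S2 _.
  have pos_t : spine_pos t = (spine_pos u).+1 by rewrite [LHS]/spine_pos /=; lia.
  exists t; first by case: (folded_adj_spine n_odd u_odd t_odd pos_t).
  rewrite t_odd pos_t; case: (nat_of_ord t =P w) => [tw|_]; last by lia.
  by rewrite -tw t_odd pos_t; lia.
- have t_lt : ((2 * (spine_pos u).-1).+1 < n)%N by lia.
  pose t := Ordinal t_lt.
  have t_odd : odd t := odd_S2 _.
  have pos_t : spine_pos u = (spine_pos t).+1.
    by rewrite [spine_pos t]/spine_pos /=; lia.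
  exists t; first by case: (folded_adj_spine n_odd t_odd u_odd pos_t).
  rewrite t_odd pos_t; case: (nat_of_ord t =P w) => [<-|_]; first by rewrite t_odd; lia.
  by rewrite pos_t in gt_uw; lia.
have w_even : ~~ odd w.
  by apply/negP => /spine_pos_odd wE; apply: u_neq_w; rewrite uE wE eq_uw.
exists w; first by case: (folded_adj_leaf n_odd u_odd w_even (esym eq_uw)).
by rewrite eqxx eq_uw subnn w_even.
Qed.

(** * The three distance formulas *)

(** Doubling, and truncated differences in place of the absolute value, keep the formula within the
    naturals. *)
Lemma folded_dist_odd (v w : nat) : odd v -> odd w ->
  ((v - w) + (w - v) = 2 * folded_dist v w)%N.
Proof.
move=> v_odd w_odd; rewrite /folded_dist; case: eqP => [->|_].
  by rewrite subnn.
rewrite v_odd w_odd !addn0 {1 2}(spine_pos_odd v_odd) {1 2}(spine_pos_odd w_odd).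
by rewrite !subSS -!mulnBr -mulnDr.
Qed.

(** Both [v] and [w.+1] have the form 2k + 2 with k the position of [v], resp. [w]; the added 2 is
    the doubled edge from the leaf [v]. *)
Lemma folded_dist_even_odd (v w : nat) : ~~ odd v -> v != 0%N -> odd w ->
  ((v - w.+1) + (w.+1 - v) + 2 = 2 * folded_dist v w)%N.
Proof.
move=> v_even v_neq0 w_odd; rewrite /folded_dist; case: eqP => [vw|_].
  by rewrite vw w_odd in v_even.
rewrite v_even w_odd addn0 {1 2}(spine_pos_even v_even v_neq0).
by rewrite {1 2}(spine_pos_odd w_odd) !subSS -!mulnBr -mulnDr [RHS]mulnDr.
Qed.

Lemma folded_dist_even (v w : nat) : ~~ odd v -> v != 0%N ->
  ~~ odd w -> w != 0%N -> v <> w ->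
  ((v - w) + (w - v) + 4 = 2 * folded_dist v w)%N.
Proof.
move=> v_even v_neq0 w_even w_neq0 /eqP/negPf v_neq_w; rewrite /folded_dist v_neq_w.
rewrite v_even w_even {1 2}(spine_pos_even v_even v_neq0).
by rewrite {1 2}(spine_pos_even w_even w_neq0) !subSS -!mulnBr -mulnDr -addnA
  [RHS]mulnDr.
Qed.

Theorem proposition23
  (p : nat) (p_prime : prime p)
  (p_mod : (p = 71 %[mod 120])%N \/ (p = 119 %[mod 120])%N)
  (P : set algC) (P_prime : is_prime_ideal (quad_int p) P)
  (P_above2 : lies_above P 2)
  (n : nat) (ord_P : is_class_order (quad_int p) P n)
  (v w : 'I_n) (v_neq0 : (v : nat) <> 0%N) (w_neq0 : (w : nat) <> 0%N) :
  let d := graph_dist (@folded_adj n) in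
  let v' : rat := (v : nat)%:R in
  let w' : rat := (w : nat)%:R in
  [/\ (odd v /\ odd w) \/ v = w -> (d v w)%:R = `|v' - w'| / 2,
      ~~ odd v -> odd w -> (d v w)%:R = `|v' - w' - 1| / 2 + 1,
      ~~ odd v -> ~~ odd w -> v <> w -> (d v w)%:R = `|v' - w'| / 2 + 2
    & d v w = d w v].
Proof.
(* The numbers 120, 71 + 1 and 119 + 1 are all multiples of 8. *)
have [r pE] : exists r, p.+1 = (8 * r)%N.
  have pE := divn_eq p 120; move: (p %/ 120)%N pE => k pE.
  by case: p_mod => p_mod; rewrite p_mod modn_small // in pE;
    [exists (15 * k + 9)%N|exists (15 * k + 15)%N]; rewrite pE; lia.
have n_odd := class_order_odd p_prime pE P_prime P_above2 ord_P.
move=> d v' w'; rewrite /d !graph_dist_folded // {d}.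
have dist_natr (a b : nat) : `|a%:R - b%:R| = ((a - b) + (b - a))%:R :> rat.
  have [le_ab|/ltnW le_ba] := leqP a b.
    by rewrite distrC (eqP le_ab) add0n natrB // ger0_norm // subr_ge0 ler_nat.
  by rewrite (eqP le_ba) addn0 natrB // ger0_norm // subr_ge0 ler_nat.
have half (a b : nat) : (a = 2 * b)%N -> b%:R = a%:R / 2 :> rat.
  by move=> ->; rewrite natrM mulrC mulKf.
rewrite {}/v' {}/w'.
split=> [[[v_odd w_odd]|->]|v_even w_odd|v_even w_even v_neq_w|].
- by rewrite dist_natr; apply: half; exact: folded_dist_odd.
- by rewrite /folded_dist eqxx subrr normr0 mul0r.
- rewrite -addrA -opprD natr1 dist_natr.
  rewrite (half _ _ (folded_dist_even_odd v_even (introN eqP v_neq0) w_odd)).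
  by rewrite natrD mulrDl divff.
- have {}v_neq_w : v <> w :> nat by move/val_inj.
  rewrite dist_natr (half _ _ (folded_dist_even v_even (introN eqP v_neq0)
    w_even (introN eqP w_neq0) v_neq_w)).
  by rewrite natrD mulrDl (natrM _ 2 2) mulfK.
exact: folded_distC.
Qed.
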